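(* Let $H\in(0,1)$, $\alpha>0$, and let $$R_{S,\alpha}(t)=e^{-\alpha H t}\Bigl(e^{2\alpha H t}+1-\tfrac12\bigl[(e^{\alpha t}+1)^{2H}+|e^{\alpha t}-1|^{2H}\bigr]\Bigr),\qquad t\in\mathbb{R}.$$ Then, as $t\to\infty$, $$R_{S,\alpha}(t)=e^{-\alpha H t}+O\bigl(e^{-(2-H)\alpha t}\bigr),$$ and hence $\lim_{t\to\infty}R_{S,\alpha}(t)=0$.
   Context: The function $R_{S,\alpha}$ is the autocovariance function of the stationary process $S_H^{\mathrm{LT}}(t)=e^{-\alpha Ht}S_H(e^{\alpha t})$, $t\in\mathbb{R}$, where $S_H$ is sub-fractional Brownian motion, i.e. the centred Gaussian process on $[0,\infty)$ with covariance $s^{2H}+t^{2H}-\frac12((s+t)^{2H}+|t-s|^{2H})$. *)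

(* Defs.v *)
From HB Require Import structures.
From mathcomp Require Import all_boot all_order all_algebra.
From mathcomp Require Import all_classical all_reals all_analysis.

Set Implicit Arguments.
Unset Strict Implicit.
Unset Printing Implicit Defensive.

Import Order.TTheory GRing.Theory Num.Theory.
Import numFieldNormedType.Exports.

Local Open Scope ring_scope.

(* Autocovariance function of the Lamperti transform
   t |-> e^{- alpha H t} S_H(e^{alpha t}) of sub-fractional Brownian motion S_H;
   it is the covariance of S_H at (s, t) = (e^{alpha t}, 1), rescaled.  Since
   0 `^ p = 0 for p <> 0, the absolute value at t = 0 causes no special case. *)
Definition RS (R : realType) (H alpha t : R) : R :=
  expR (- (alpha * H * t)) *
  (expR (2 * alpha * H * t) + 1
   - 2^-1 * ((expR (alpha * t) + 1) `^ (2 * H)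
             + `|expR (alpha * t) - 1| `^ (2 * H))).

(* Lets the Landau notations take +oo as their filter. *)
Canonical pinfty_filter_on (R : numFieldType) :=
  FilterType (pinfty_nbhs R) _.

(* Main.v *)
Require Import Defs.
From mathcomp Require Import all_boot all_order all_algebra.
From mathcomp Require Import all_classical all_reals all_analysis.
From mathcomp Require Import ring lra.

Import Order.TTheory GRing.Theory Num.Theory.
Import numFieldNormedType.Exports.

Local Open Scope ring_scope.
Local Open Scope classical_set_scope.

(** Put u = e^(-alpha t).  For t > 0, factoring out e^(2 alpha H t) gives
    R(t) - e^(-alpha H t) = e^(alpha H t) (1 - ((1+u)^(2H) + (1-u)^(2H)) / 2),
    so it is enough that the second difference (1+u)^(2H) + (1-u)^(2H) - 2 is
    at most 2 u^2 in absolute value.  Since 0 < H < 1 this needs no Taylor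
    expansion: the upper bound is Bernoulli's inequality for the H-th powers of
    (1+u)^2 and (1-u)^2, and the lower bound is AM-GM followed by
    (1-u^2)^H >= 1-u^2. *)

(** Young's inequality for the product of a^r and 1, with conjugate exponents 1/r and 1/(1-r): the
    right-hand side is r a + (1 - r). *)
Lemma powR_Bernoulli (R : realType) (r a : R) :
  0 < r < 1 -> 0 <= a -> a `^ r <= 1 + r * (a - 1).
Proof.
move=> /andP[r0 r1] a0.
have s0 : 0 < 1 - r by lra.
have := @conjugate_powR R (a `^ r) 1 r^-1 (1 - r)^-1 (powR_ge0 _ _) ler01.
rewrite !invr_gt0 !invrK mulr1 => /(_ r0 s0).
rewrite -powRrM divff ?gt_eqF// powRr1// powR1 mul1r => Young.
by apply: le_trans (Young _) _; [ring | lra].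
Qed.

Lemma second_difference_powR_le (R : realType) (H u : R) :
  0 < H < 1 -> 0 < u < 1 ->
  `|(1 + u) `^ (2 * H) + (1 - u) `^ (2 * H) - 2| <= 2 * u ^+ 2.
Proof.
move=> H01 /andP[u0 u1]; have /andP[H0 H1] := H01.
have pu : 0 <= 1 + u by lra.
have mu : 0 <= 1 - u by lra.
have upper (v : R) : 0 <= v -> v `^ (2 * H) <= 1 + H * (v ^+ 2 - 1).
  by move=> v0; rewrite powRrM powR_mulrn// powR_Bernoulli// exprn_ge0.
have uu : u ^+ 2 <= 1 by rewrite expr_le1// ltW.
have v1 : 0 < 1 - u ^+ 2 <= 1 by nra.
have AMGM : 2 * (1 - u ^+ 2) `^ H <= (1 + u) `^ (2 * H) + (1 - u) `^ (2 * H).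
  have -> : 1 - u ^+ 2 = (1 + u) * (1 - u) by ring.
  rewrite powRM// ![2 * H]mulrC !powRrM !powR_mulrn ?powR_ge0//.
  by have := sqr_ge0 ((1 + u) `^ H - (1 - u) `^ H); nra.
have lower := ger1_powR v1 (ltW H1).
(* In the sum of the two upper bounds the terms linear in u cancel, leaving 2 + 2 H u^2. *)
have := upper _ pu; have := upper _ mu.
have Hu2 : H * u ^+ 2 <= u ^+ 2 by rewrite ler_piMl// ?sqr_ge0// ltW.
by move=> ? ?; rewrite ler_norml; apply/andP; split; nra.
Qed.

(** The constant is 1 because the factor 1/2 in [RS] cancels the 2 in the bound 2 u^2. Taking t > 0
    makes u < 1, so the absolute value in [RS] opens as e^(alpha t) (1 - u). *)
Lemma RS_sub_expR_le (R : realType) (H alpha t : R) :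
  0 < H < 1 -> 0 < alpha -> 0 < t ->
  `|RS H alpha t - expR (- (alpha * H * t))| <=
  expR (- ((2 - H) * alpha * t)).
Proof.
move=> H01 alpha0 t0.
pose u := expR (- (alpha * t)).
have u01 : 0 < u < 1 by rewrite expR_gt0 expR_lt1 oppr_lt0 mulr_gt0.
have /andP[u0 u1] := u01.
have xu : expR (alpha * t) * u = 1 by rewrite -expRD subrr expR0.
have x0 := expR_ge0 (alpha * t).
have E : expR (alpha * t) `^ (2 * H) = expR (2 * alpha * H * t).
  by rewrite -expRM; congr expR; ring.
have Ep : (expR (alpha * t) + 1) `^ (2 * H) =
    expR (2 * alpha * H * t) * (1 + u) `^ (2 * H).
  rewrite -E -powRM ?mulrDr ?mulr1 ?xu//; lra.
have Em : `|expR (alpha * t) - 1| `^ (2 * H) =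
    expR (2 * alpha * H * t) * (1 - u) `^ (2 * H).
  rewrite ger0_norm; last by rewrite subr_ge0 ltW// expR_gt1 mulr_gt0.
  rewrite -E -powRM ?mulrBr ?mulr1 ?xu//; lra.
(* The summand 1 in [RS] contributes exactly the subtracted e^(-alpha H t); all that is left carries
   the factor e^(2 alpha H t). *)
have -> : RS H alpha t - expR (- (alpha * H * t)) =
    expR (alpha * H * t) *
    (- 2^-1 * ((1 + u) `^ (2 * H) + (1 - u) `^ (2 * H) - 2)).
  have -> : expR (alpha * H * t) =
      expR (- (alpha * H * t)) * expR (2 * alpha * H * t).
    by rewrite -expRD; congr expR; ring.
  by rewrite /RS Ep Em; field.
have -> : expR (- ((2 - H) * alpha * t)) = expR (alpha * H * t) * u ^+ 2.
  by rewrite -expRM_natl -expRD; congr expR; ring.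
rewrite !normrM (ger0_norm (expR_ge0 _)) ler_wpM2l ?expR_ge0//.
rewrite normrN normfV normr_nat ler_pdivrMl//.
exact: second_difference_powR_le.
Qed.

Lemma cvgr_expR_scale (R : realType) (c : R) : 0 < c ->
  expR (- (c * t)) @[t --> +oo%R] --> (0 : R).
Proof.
move=> c0.
apply: (@cvg_comp _ _ _ ( *%R c) (fun y => expR (- y)) _ (pinfty_nbhs R)).
  exact: gt0_cvgMry.
exact: cvgr_expR.
Qed.

Theorem lemma2p7 (R : realType) (H alpha : R)
  (H_gt0 : 0 < H) (H_lt1 : H < 1) (alpha_gt0 : 0 < alpha) :
  RS H alpha = (fun t : R => expR (- (alpha * H * t)))
    +O_ (+oo_ R) (fun t : R => expR (- ((2 - H) * alpha * t)))
  /\ RS H alpha t @[t --> +oo%R] --> (0 : R).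
Proof.
have H01 : 0 < H < 1 by rewrite H_gt0.
have bound : \forall t \near +oo%R,
    `|RS H alpha t - expR (- (alpha * H * t))| <=
    expR (- ((2 - H) * alpha * t)).
  apply: filterS (nbhs_pinfty_gt (num_real 0)) => t.
  exact: RS_sub_expR_le.
split.
  (* The Landau constant k ranges over a neighbourhood of +oo; as [bound] has constant 1, every k >=
     1 serves. *)
  apply/eqaddOP; apply: filterS (nbhs_pinfty_ge (num_real 1)) => k k1.
  apply: filterS bound => t /= le_t; rewrite (le_trans le_t)//.
  by rewrite (ger0_norm (expR_ge0 _)) ler_peMl ?expR_ge0.
(* Error and main term vanish separately, since the rates (2 - H) alpha and alpha H are both
   positive. *)
have cvgD0 : RS H alpha t - expR (- (alpha * H * t)) @[t --> +oo%R] --> (0 : R).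
  apply/norm_cvg0P.
  apply: squeeze_cvgr (cvg_cst 0) (cvgr_expR_scale _ ((2 - H) * alpha) _).
    by apply: filterS bound => t ->; rewrite normr_ge0.
  by rewrite mulr_gt0//; lra.
have -> : RS H alpha =
    (fun t => RS H alpha t - expR (- (alpha * H * t)) + expR (- (alpha * H * t))).
  by apply/funext => t; rewrite subrK.
rewrite -[0 in X in _ --> X]addr0.
exact: cvgD cvgD0 (cvgr_expR_scale _ _ (mulr_gt0 alpha_gt0 H_gt0)).
Qed.
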